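(* Let $V$ be a diffeological vector space whose smooth linear functionals separate points. Then every finite-dimensional subspace $W$ of $V$ is a smooth direct summand of $V$.
   Context: A diffeological space is a set $X$ together with a specified set of functions $U\to X$ (called plots) for each open set $U\subseteq\mathbb{R}^n$ and each $n\in\mathbb{N}$, such that: (1) every constant function $U\to X$ is a plot; (2) if $U\to X$ is a plot and $V\to U$ is smooth ($V$ open in some $\mathbb{R}^m$), then the composite $V\to U\to X$ is a plot; (3) if $U=\bigcup_i U_i$ is an open cover and $U\to X$ is a function each of whose restrictions $U_i\to X$ is a plot, then $U\to X$ is a plot. A function $f:X\to Y$ between diffeological spaces is smooth if $f\circ p$ is a plot of $Y$ for every plot $p$ of $X$. $\mathbb{R}^n$ carries the standard diffeology (plots are the usual smooth maps). Subsets carry the sub-diffeology (plots are the functions that are plots of the ambient space) and products carry the product diffeology (plots are the functions all of whose components are plots). A diffeological vector space is a real vector space $V$ with a diffeology such that addition $V\times V\to V$ and scalar multiplication $\mathbb{R}\times V\to V$ are smooth. A subspace means a linear subspace with the sub-diffeology. The smooth linear functionals on $V$ separate points if for all $x\neq y$ in $V$ there is a smooth linear map $f:V\to\mathbb{R}$ with $f(x)\neq f(y)$. A subspace $W$ of $V$ is a smooth direct summand if there is a smooth linear map $r:V\to W$ such that the composite of the inclusion $W\hookrightarrow V$ with $r$ is $1_W$. *)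

(* Defs.v *)
From HB Require Import structures.
From mathcomp Require Import all_boot all_order all_algebra.
From mathcomp Require Import all_classical all_reals topology normedtype derive.

Set Implicit Arguments.
Unset Strict Implicit.
Unset Printing Implicit Defensive.

Import Order.TTheory GRing.Theory Num.Theory.
Import numFieldNormedType.Exports.

Local Open Scope classical_set_scope.
Local Open Scope ring_scope.

Section Smooth.
Context {R : realType} {E : normedModType R} {n : nat}.
Implicit Types (U : set 'rV[R]_n) (f : 'rV[R]_n -> E).

Definition partial (i : 'I_n) f : 'rV[R]_n -> E := 'D_(delta_mx 0 i) f.

Definition iter_partial (s : seq 'I_n) f : 'rV[R]_n -> E := foldr partial f s.

(* C^infinity on U, for U open: all iterated partial derivatives exist and are
   continuous at every point of U. For open U this only depends on the
   restriction of f to U. *)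
Definition smooth_on U f : Prop :=
  forall (s : seq 'I_n) (x : 'rV[R]_n), U x ->
    {for x, continuous (iter_partial s f)} /\
    forall i : 'I_n, derivable (iter_partial s f) x (delta_mx 0 i).

End Smooth.

(* A function U -> X on a subset U of R^n is represented by a function
   'rV_n -> X whose values outside U are irrelevant (see plot_congr). *)
Definition plots (R : realType) (X : Type) : Type :=
  forall n : nat, set 'rV[R]_n -> ('rV[R]_n -> X) -> Prop.

Record diffeology (R : realType) (X : Type) (D : plots R X) : Prop := {
  plot_open : forall n (U : set 'rV[R]_n) (p : 'rV[R]_n -> X),
    D n U p -> open U;
  plot_congr : forall n (U : set 'rV[R]_n) (p q : 'rV[R]_n -> X),
    (forall x, U x -> p x = q x) -> D n U p -> D n U q;
  plot_cst : forall n (U : set 'rV[R]_n) (x : X),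
    open U -> D n U (fun=> x);
  plot_comp : forall m n (V : set 'rV[R]_m) (U : set 'rV[R]_n)
      (g : 'rV[R]_m -> 'rV[R]_n) (p : 'rV[R]_n -> X),
    open V -> smooth_on V g -> (forall y, V y -> U (g y)) ->
    D n U p -> D m V (p \o g);
  plot_cover : forall n (U : set 'rV[R]_n) (I : Type)
      (A : I -> set 'rV[R]_n) (p : 'rV[R]_n -> X),
    (forall i, open (A i)) -> U = \bigcup_i A i ->
    (forall i, D n (A i) p) -> D n U p }.

Definition smooth (R : realType) (X Y : Type) (DX : plots R X) (DY : plots R Y)
    (f : X -> Y) : Prop :=
  forall n (U : set 'rV[R]_n) (p : 'rV[R]_n -> X), DX n U p -> DY n U (f \o p).

Definition standard_plots (R : realType) (E : normedModType R) : plots R E :=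
  fun n U p => open U /\ smooth_on U p.

Definition sub_plots (R : realType) (X : Type) (P : pred X) (S : subType P)
    (D : plots R X) : plots R S :=
  fun n U p => D n U (fun x => val (p x)).

Definition prod_plots (R : realType) (X Y : Type) (DX : plots R X)
    (DY : plots R Y) : plots R (X * Y) :=
  fun n U p => DX n U (fun x => (p x).1) /\ DY n U (fun x => (p x).2).

Definition real_plots (R : realType) : plots R R := @standard_plots R _.
Arguments real_plots : clear implicits.

Record diffeological_vector_space (R : realType) (V : lmodType R)
    (D : plots R V) : Prop := {
  dvs_diffeology : diffeology D;
  dvs_add : smooth (prod_plots D D) D (fun z : V * V => z.1 + z.2);
  dvs_scale :
    smooth (prod_plots (real_plots R) D) D (fun z : R * V => z.1 *: z.2) }.

Definition smooth_functionals_separate_points (R : realType) (V : lmodType R)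
    (D : plots R V) : Prop :=
  forall x y : V, x <> y ->
    exists f : {scalar V}, smooth D (real_plots R) f /\ f x <> f y.

Definition finite_dimensional (R : realType) (W : lmodType R) : Prop :=
  exists (n : nat) (b : 'I_n -> W), forall w : W,
    exists c : 'I_n -> R, w = \sum_(i < n) c i *: b i.

Definition smooth_direct_summand (R : realType) (V : lmodType R)
    (D : plots R V) (S : pred V) (W : subLmodType S) : Prop :=
  exists r : {linear V -> W},
    smooth D (sub_plots (S := W) D) r /\ forall w : W, r (val w) = w.

(* Main.v *)
Require Import Defs.
From HB Require Import structures.
From mathcomp Require Import all_boot all_order all_algebra.
From mathcomp Require Import all_classical all_reals topology normedtype derive.

(** A linear functional [f] that does not vanish on a vector [u] of [W] lets one
    enlarge a smooth linear map [r : V -> W] that already fixes some vectors of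
    [W]: the map [v |-> r v + f (v - r v) *: u] agrees with [r] wherever [r] is
    the identity, and if [u] is the error [w - r w] at a further vector [w],
    with [f] scaled so that [f u = 1], then it also fixes [w].  Smooth
    functionals separate points, so such an [f] exists whenever the error is
    nonzero.  Starting from [r = 0] and treating the vectors of a finite spanning
    family of [W] one at a time ([partial_retraction]) gives a smooth linear map
    that is the identity on [W].

    Enlarging [r] in this way, rather than first choosing a dual family of
    functionals, keeps the smoothness argument formal: only the smooth addition
    and scaling of [V] are used, and the sole fact from calculus is that
    constants are smooth. *)

Set Implicit Arguments.
Unset Strict Implicit.
Unset Printing Implicit Defensive.

Import GRing.Theory.
Import numFieldNormedType.Exports.

Local Open Scope classical_set_scope.
Local Open Scope ring_scope.

Lemma smooth_on_cst (R : realType) (E : normedModType R) n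
    (U : set 'rV[R]_n) (a : E) : smooth_on U (fun=> a).
Proof.
(* Derivatives of a constant are constant, though not with the same value. *)
have iter_cst (s : seq 'I_n) : exists b : E, iter_partial s (fun=> a) = (fun=> b).
  elim: s => [|i s [b /= ->]]; first by exists a.
  by exists 0; apply/funext => x; exact: derive_cst.
move=> s x _; have [b ->] := iter_cst s; split=> [|i].
  exact: cst_continuous.
exact: derivable_cst.
Qed.

Section SmoothMaps.
Variables (R : realType) (V : lmodType R) (D : plots R V).
Hypothesis hV : diffeological_vector_space D.

Lemma smooth_addf (X : Type) (DX : plots R X) (g h : X -> V) :
  smooth DX D g -> smooth DX D h -> smooth DX D (fun x => g x + h x).
Proof.
move=> sg sh n U p Dp.
exact: (dvs_add hV (p := fun x => (g (p x), h (p x)))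
  (conj (sg _ _ _ Dp) (sh _ _ _ Dp))).
Qed.

Lemma smooth_scalef (X : Type) (DX : plots R X) (c : X -> R) (g : X -> V) :
  smooth DX (real_plots R) c -> smooth DX D g ->
  smooth DX D (fun x => c x *: g x).
Proof.
move=> sc sg n U p Dp.
exact: (dvs_scale hV (p := fun x => (c (p x), g (p x)))
  (conj (sc _ _ _ Dp) (sg _ _ _ Dp))).
Qed.

Lemma smooth_cstf (v : V) : smooth D D (fun=> v).
Proof.
move=> n U p /(plot_open (dvs_diffeology hV)).
exact: (plot_cst (dvs_diffeology hV)).
Qed.

Lemma smooth_scalar_cst (a : R) : smooth D (real_plots R) (fun=> a).
Proof.
move=> n U p /(plot_open (dvs_diffeology hV)) oU; split => //.
exact: smooth_on_cst.
Qed.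

Lemma smooth_subf (g h : V -> V) :
  smooth D D g -> smooth D D h -> smooth D D (fun x => g x - h x).
Proof.
move=> sg sh; have -> : (fun x => g x - h x) = (fun x => g x + -1 *: h x).
  by apply/funext => x; rewrite scaleN1r.
exact/smooth_addf/smooth_scalef/sh/smooth_scalar_cst.
Qed.

End SmoothMaps.

Section Correction.
Variables (R : realType) (V : lmodType R) (S : pred V) (W : subLmodType S).

Implicit Types (r : {linear V -> W}) (f : {scalar V}) (u : W).

Definition correction r f u (v : V) : W :=
  r v + f (v - val (r v)) *: u.

Lemma correction_is_linear r f u : linear (correction r f u).
Proof.
move=> a x y; rewrite /correction.
have -> : a *: x + y - val (r (a *: x + y)) =
          a *: (x - val (r x)) + (y - val (r y)).
  by rewrite (linearP r) (linearP (val : {linear W -> V})) scalerBr opprD addrACA.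
by rewrite (linearP r) (linearP f) scalerDl scalerDr scalerA addrACA.
Qed.

HB.instance Definition _ r f u :=
  GRing.isLinear.Build R V W *:%R (correction r f u) (correction_is_linear r f u).

Lemma correction_id r f u (w : W) :
  r (val w) = w -> correction r f u (val w) = w.
Proof. by rewrite /correction => ->; rewrite subrr linear0 scale0r addr0. Qed.

(** Plots of [W] are plots of [V] landing in [W], so it suffices to look at the
    correction as a map into [V], where the smooth operations of [V] apply. *)
Lemma correction_smooth (D : plots R V) r f u :
  diffeological_vector_space D ->
  smooth D (sub_plots (S := W) D) r -> smooth D (real_plots R) f ->
  smooth D (sub_plots (S := W) D) (correction r f u).
Proof.
move=> hV sr sf.
have s_val : smooth D D (fun v => val (r v)) by exact: sr.
have s_id : smooth D D id by [].
have s_err := smooth_subf hV s_id s_val.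
suff : smooth D D (fun v => val (correction r f u v)) by [].
have -> : (fun v => val (correction r f u v)) =
          (fun v => val (r v) + f (v - val (r v)) *: val u).
  by apply/funext => v; rewrite /correction linearD linearZ.
apply: smooth_addf => //; apply: smooth_scalef => //; last exact: smooth_cstf.
by move=> n U p /s_err/sf.
Qed.

(** The induction step corrects [r] by the error at one more vector [w].  If
    that error is zero nothing is to be done; otherwise dividing it by the value
    of a functional that detects it makes the correction at [w] exact. *)
Lemma partial_retraction (D : plots R V) (s : seq W) :
  diffeological_vector_space D -> smooth_functionals_separate_points D ->
  exists r : {linear V -> W},
    smooth D (sub_plots (S := W) D) r /\ {in s, forall w, r (val w) = w}.
Proof.
move=> hV hsep; elim: s => [|w s [r [sr rs]]].
  exists \0; split=> //.
  suff : smooth D D (fun v => val (0 : W)) by [].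
  exact: smooth_cstf.
have [rw|/eqP rw] := eqVneq (r (val w)) w.
  by exists r; split=> // x; rewrite inE => /predU1P[->//|/rs].
pose u := w - r (val w).
have u_neq0 : val u <> 0.
  rewrite -(linear0 (val : {linear W -> V})) => /val_inj/eqP.
  by rewrite subr_eq0 eq_sym => /eqP.
have [f [sf]] := hsep _ _ u_neq0; rewrite linear0 => /eqP fu.
exists (correction r f ((f (val u))^-1 *: u)); split; first exact: correction_smooth.
move=> x; rewrite inE => /predU1P[->|/rs]; last exact: correction_id.
by rewrite /= /correction -linearB -/u scalerA divff // scale1r addrC subrK.
Qed.

End Correction.

Theorem theorem4p2 (R : realType) (V : lmodType R) (D : plots R V)
    (hV : diffeological_vector_space D)
    (hsep : smooth_functionals_separate_points D)
    (S : pred V) (W : subLmodType S) (hW : finite_dimensional W) :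
  smooth_direct_summand D W.
Proof.
have [n [b b_span]] := hW.
have [r [sr rb]] := partial_retraction [seq b i | i : 'I_n] hV hsep.
exists r; split=> // w; have [c ->] := b_span w.
rewrite !linear_sum; apply: eq_bigr => i _.
by rewrite !linearZ /= rb //; apply/mapP; exists i => //; rewrite mem_enum.
Qed.
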